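(* Let $p$ be a prime number and let $D$ be a finite-dimensional $p$-division algebra over its centre $Z$. Let $K \subseteq D$ be a commutative extension field of $Z$, and let $d \geq 0$ be an integer. The following are equivalent: (i) there exists a torus $T \subseteq K$ of rank $d$ such that $K = Z(T)$; (ii) $K$ is a Galois extension of $Z$, and $\mathrm{Gal}(K/Z)$ is a $p$-elementary abelian group of rank $d$ (i.e. isomorphic to $(\mathbb{Z}/p\mathbb{Z})^d$).
   Context: A $p$-division algebra is a division ring $D$ of characteristic $p>0$ whose dimension over its centre $Z$ is a (finite) power of $p$. An element $t \in D$ is called toral if $t^p - t \in Z$. A torus in $D$ is a commutative $Z$-subspace $T \subseteq D$ (its elements commute pairwise) that is spanned over $Z$ by toral elements; by convention only tori containing $1$ are considered. For $t\in D$, $\mathrm{ad}(t)$ denotes the inner derivation $x \mapsto [t,x] = tx - xt$ of $D$. The rank of $T$ is $\dim_Z \mathrm{ad}(T)$, where $\mathrm{ad}(T) = \{\mathrm{ad}(t) : t \in T\}$. $Z(T)$ denotes the subfield of $D$ generated by $Z$ and $T$. *)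

(* Defs.v *)
From HB Require Import structures.
From mathcomp Require Import all_boot all_order all_fingroup all_algebra.
From mathcomp Require Import all_solvable all_field.

Set Implicit Arguments.
Unset Strict Implicit.
Unset Printing Implicit Defensive.

Import GRing.Theory.
Local Open Scope ring_scope.

Section DivisionAlgebra.
Variables (Z : fieldType) (D : falgType Z).

(* Finiteness of the dimension is part of [falgType Z], and [Z] is identified *)
(* with the line [1%VS] of its scalar multiples of [1] in [D].                *)
Record p_division_algebra (p : nat) : Prop := PDivisionAlgebra {
  pdiv_unit : forall x : D, x != 0 -> x \is a GRing.unit;
  pdiv_center : 'Z({:D})%VS = 1%VS;
  pdiv_char : p \in [pchar D];
  pdiv_dim : exists n : nat, \dim {:D} = (p ^ n)%N
}.

Definition toral (p : nat) (t : D) : bool := t ^+ p - t \in 'Z({:D})%VS.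

Record torus (p : nat) (T : {vspace D}) : Prop := Torus {
  torus_comm : {in T &, commutative *%R};
  torus_span : exists2 s : seq D, all (toral p) s & T = <<s>>%VS;
  torus1 : 1 \in T
}.

Definition ad (t : D) : 'End(D) := amull t - amulr t.

Lemma adE t x : ad t x = t * x - x * t.
Proof. by rewrite /ad add_lfunE opp_lfunE !lfunE. Qed.

Fact ad_is_linear : linear ad.
Proof.
by move=> a u v; rewrite /ad linearP (linearP (@amulr Z D)) scalerBr opprD addrACA.
Qed.
HB.instance Definition _ :=
  GRing.isSemilinear.Build Z D 'End(D) _ ad (GRing.semilinear_linear ad_is_linear).

(* [linfun] only packages the linear map [ad] as an element of 'Hom, so that  *)
(* its image of a subspace can be formed.                                     *)
Definition torus_rank (T : {vspace D}) : nat := \dim (linfun ad @: T).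

(* An [{aspace D}] is closed under Z-scaling, sums and products; together     *)
(* with [1] it thus contains the copy of [Z] in [D].                          *)
Record is_extension_field (K : {aspace D}) : Prop := IsExtensionField {
  extf1 : 1 \in K;
  extf_comm : {in K &, commutative *%R};
  extf_inv : {in K, forall x, x^-1 \in K}
}.

(* [K] is Z(T), the smallest subfield of [D] containing [Z] and [T]. Subfields *)
(* containing [Z] are automatically Z-subspaces, hence range over {aspace D}.  *)
Definition generated_field (T : {vspace D}) (K : {aspace D}) : Prop :=
  [/\ is_extension_field K, (T <= K)%VS &
      forall F : {aspace D}, is_extension_field F -> (T <= F)%VS -> (K <= F)%VS].

Section FieldStructure.
Variables (p : nat) (K : {aspace D}).
Hypotheses (hD : p_division_algebra p) (hK : is_extension_field K).

Fact subvs_mulC : commutative (@GRing.mul (subvs_of K)).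
Proof. by move=> x y; apply/val_inj/(extf_comm hK); apply: subvsP. Qed.

Fact subvs_unit (x : subvs_of K) : x != 0 -> x \is a GRing.unit.
Proof.
by move=> nz_x; apply/vsval_unitr/(pdiv_unit hD); rewrite -(inj_eq val_inj) in nz_x.
Qed.

(* The Z-algebra [subvs_of K] with its inherited operations, as a field.      *)
Definition extension_field : fieldExtType Z :=
  let fK : falgType Z := subvs_of K in
  let cK : comUnitRingType :=
    HB.pack (subvs_of K) fK
      (GRing.PzRing_hasCommutativeMul.Build (subvs_of K) subvs_mulC) in
  HB.pack (subvs_of K) fK cK (GRing.ComUnitRing_isField.Build cK subvs_unit).

End FieldStructure.
End DivisionAlgebra.

(* The library's Galois groups are only defined for normal extensions, i.e.,  *)
(* for a [splittingFieldType]: [nL] is the normality of L / Z, and [galois]   *)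
(* then adds separability.                                                    *)
Definition splitting_pack (Z : fieldType) (L : fieldExtType Z)
    (nL : SplittingField.axiom L) : splittingFieldType Z :=
  HB.pack (L : Type) L (FieldExt_isSplittingField.Build Z L nL).

Definition galois_with_group (Z : fieldType) (L : fieldExtType Z)
    (gT : finGroupType) (G : {group gT}) : Prop :=
  exists nL : SplittingField.axiom L,
    let S := splitting_pack nL in
    galois 1%VS {:S} /\ 'Gal({:S} / 1%VS) \isog G.

(* Main.v *)
(* Since [ad] has kernel [Z], a torus of rank [d] has a [Z]-basis of toral    *)
(* elements [1, t_1, ..., t_d]. Each polynomial [X^p - X - (t_i^p - t_i)] has *)
(* the [p] distinct roots [t_i + a] with [a] in [F_p], so [K = Z(t_1, ...,    *)
(* t_d)] is Galois, and [s |-> (s t_i - t_i)_i] embeds its group in [F_p^d].  *)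
(* If a nonzero linear form [c] killed the image, then [\sum_i c_i t_i] would *)
(* be fixed, hence in [Z], against independence; so the embedding is onto.    *)
(* Conversely, given [Gal(K/Z)] isomorphic to [F_p^d], additive Hilbert 90    *)
(* applied to the [d] coordinate homomorphisms gives [t_1, ..., t_d] in [K]   *)
(* with [s t_i - t_i] the coordinates of [s]: then [1, t_1, ..., t_d] span    *)
(* the required torus.                                                        *)

Require Import Defs.
From HB Require Import structures.
From mathcomp Require Import all_boot all_order all_fingroup all_algebra.
From mathcomp Require Import all_solvable all_field.
From mathcomp Require Import mxabelem.

Set Implicit Arguments.
Unset Strict Implicit.
Unset Printing Implicit Defensive.

Import GRing.Theory.
Local Open Scope ring_scope.

(** The question is moved from [D] to the abstract field [L] attached to [K], where
    [galois_with_elementary_groupP] settles it: the group is [F_p^d] exactly when [L] is generated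
    by [d] toral elements independent together with [1]. Given generators, [Artin_Schreier_factor]
    yields normality and separability, and [toral_shift] identifies the group. Given the group,
    [toral_of_hom] realises each of its coordinates as the shift of a toral element.

    The embedding [extension_field_val] matches these generators with tori: [free_subseq_span]
    extracts from a torus a toral basis through [1], and [torus_rankE] turns rank [d] into dimension
    [d + 1]. *)

(** * The prime subfield and Artin-Schreier polynomials *)

Section PrimeSubfield.
Variables (L : fieldType) (p : nat).
Hypothesis pcharLp : p \in [pchar L].

Let p_pr : prime p := pcharf_prime pcharLp.

Definition Fp_embed (a : 'F_p) : L := (a : nat)%:R.

Lemma Fp_embed_natr n : Fp_embed n%:R = n%:R.
Proof. by rewrite /Fp_embed val_Fp_nat // (GRing.natr_mod_pchar pcharLp). Qed.

Lemma Fp_embedD : {morph Fp_embed : a b / a + b}.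
Proof.
by move=> a b; rewrite -[a]natr_Zp -[b]natr_Zp -natrD !Fp_embed_natr natrD.
Qed.

Lemma Fp_embedM : {morph Fp_embed : a b / a * b}.
Proof.
by move=> a b; rewrite -[a]natr_Zp -[b]natr_Zp -natrM !Fp_embed_natr natrM.
Qed.

Lemma Fp_embed0 : Fp_embed 0 = 0.
Proof. by rewrite -[0]/0%:R Fp_embed_natr. Qed.

Lemma Fp_embed1 : Fp_embed 1 = 1.
Proof. by rewrite -[1]/1%:R Fp_embed_natr. Qed.

Lemma Fp_embed_eq0 a : (Fp_embed a == 0) = (a == 0).
Proof.
rewrite /Fp_embed -(dvdn_pcharf pcharLp) (dvdn_pcharf (pchar_Fp p_pr)).
by rewrite natr_Zp.
Qed.

Lemma Fp_embed_sum I r (P : pred I) (F : I -> 'F_p) :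
  Fp_embed (\sum_(i <- r | P i) F i) = \sum_(i <- r | P i) Fp_embed (F i).
Proof. exact: (big_morph _ Fp_embedD Fp_embed0). Qed.

Lemma Fp_embed_inj : injective Fp_embed.
Proof.
move=> a b eq_ab; apply/eqP; rewrite -subr_eq0 -Fp_embed_eq0.
by rewrite -(inj_eq (addIr (Fp_embed b))) -Fp_embedD subrK eq_ab add0r.
Qed.

Lemma Fp_embedX a : Fp_embed a ^+ p = Fp_embed a.
Proof. by rewrite -(pFrobenius_autE pcharLp) pFrobenius_aut_nat. Qed.

Lemma exprDp (x y : L) : (x + y) ^+ p = x ^+ p + y ^+ p.
Proof. by rewrite -!(pFrobenius_autE pcharLp) rmorphD. Qed.

Lemma exprNp (x : L) : (- x) ^+ p = - x ^+ p.
Proof. by rewrite -!(pFrobenius_autE pcharLp) rmorphN. Qed.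

(** Frobenius is additive and fixes the prime field, so translating a root by [F_p] gives [p]
    distinct roots of a monic polynomial of degree [p]. *)
Lemma Artin_Schreier_factor (t z : L) : t ^+ p - t = z ->
  'X^p - 'X - z%:P = \prod_(a : 'F_p) ('X - (t + Fp_embed a)%:P).
Proof.
move=> <-; set P := LHS; set rs := [seq t + Fp_embed a | a <- enum 'F_p].
have sizeP : size P = p.+1.
  rewrite /P -addrA size_polyDl size_polyXn // ltnS.
  rewrite -opprD size_polyN size_XaddC; exact: prime_gt1.
have monP : P \is monic.
  rewrite monicE /lead_coef sizeP /= /P !coefB coefXn eqxx coefX coefC.
  by have := prime_gt1 p_pr; case: p => [|[]] //= n _; rewrite !subr0.
have size_rs : size rs = p by rewrite size_map -cardE card_Fp.
rewrite [LHS](@all_roots_prod_XsubC _ P rs) ?size_rs //.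
- by rewrite (monicP monP) scale1r big_map big_enum.
- apply/allP=> _ /mapP[a _ ->]; rewrite rootE !hornerE.
  by rewrite exprDp Fp_embedX opprD addrACA subrr addr0 subrr.
rewrite uniq_rootsE map_inj_uniq ?enum_uniq // => a b /addrI.
exact: Fp_embed_inj.
Qed.

(** This is the factorization of [X^p - X], the case [t = z = 0], evaluated at [x]. *)
Lemma Fp_embed_surj (x : L) : x ^+ p = x -> exists a, x = Fp_embed a.
Proof.
move=> xpx; have := @Artin_Schreier_factor 0 0.
rewrite expr0n gtn_eqF ?prime_gt0 // !subr0 => /(_ erefl)/(congr1 (horner^~ x)).
rewrite !hornerE xpx subrr horner_prod => /esym/eqP/prodf_eq0[a _].
by rewrite !hornerE subr_eq0 => /eqP; exists a.
Qed.

End PrimeSubfield.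

(* Over the prime field, subgroups are subspaces. *)
Lemma Fp_subgroup_full (p d : nat) (H : {group 'rV['F_p]_d}) :
  (forall c : 'cV['F_p]_d, (forall h, h \in H -> h *m c = 0) -> c = 0) ->
  H :=: [set: 'rV['F_p]_d].
Proof.
move=> annH.
have stH : [acts setT, on H | scale_action 'F_p 1 d].
  apply/actsP=> a _ u; apply/idP/idP => /= Hu; last first.
    by rewrite scale_actE -[val a]natr_Zp scaler_nat groupX.
  rewrite -[u](actK (scale_action 'F_p 1 d) a) /=.
  by rewrite scale_actE -[val _]natr_Zp scaler_nat groupX.
apply/eqP; rewrite -subTset -(stable_rowg_mxK stH) -(rowg1 _ d) rowgS.
(* Each column of the cokernel annihilates [H], hence vanishes by hypothesis; the row space is then
   everything. *)
rewrite sub1mx -cokermx_eq0; apply/eqP/matrixP=> i j; rewrite mxE.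
have/(congr1 (fun c : 'cV_d => c i 0)) : col j (cokermx (rowg_mx H)) = 0.
  apply: annH => h /(subsetP (sub_rowg_mx H)); rewrite mem_rowg submxE.
  by move=> /eqP hA0; rewrite colE mulmxA hA0 mul0mx.
by rewrite !mxE.
Qed.

(** * From toral generators to an elementary abelian Galois group *)

Section ArtinSchreier.
Variables (Z : fieldType) (p : nat).

Section Normality.
Variables (L : fieldExtType Z) (pcharLp : p \in [pchar L]) (ts : seq L).
Hypotheses (ts_toral : {in ts, forall t, t ^+ p - t \in 1%VS})
           (ts_gen : <<1 & ts>>%VS = {:L}%VS).

Lemma Artin_Schreier_separable_poly (t z : L) :
  t ^+ p - t = z -> separable_poly ('X^p - 'X - z%:P).
Proof.
move=> /(Artin_Schreier_factor pcharLp)->; rewrite -big_enum /=.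
rewrite -(big_map (fun a => t + @Fp_embed L p a) predT (fun x => 'X - x%:P)) /=.
rewrite separable_prod_XsubC map_inj_uniq ?enum_uniq // => a b /addrI.
exact: Fp_embed_inj.
Qed.

Lemma Artin_Schreier_poly_over1 (t : L) :
  t ^+ p - t \in 1%VS -> 'X^p - 'X - (t ^+ p - t)%:P \is a polyOver 1%VS.
Proof. by move=> Zt; rewrite !rpredB ?rpredX ?polyOverX ?polyOverC. Qed.

Lemma Artin_Schreier_normal : SplittingField.axiom L.
Proof.
exists (\prod_(t <- ts) ('X^p - 'X - (t ^+ p - t)%:P)).
  rewrite big_seq; apply: rpred_prod => t ts_t.
  exact/Artin_Schreier_poly_over1/ts_toral.
exists [seq t + Fp_embed L a | t <- ts, a <- enum 'F_p].
  rewrite big_allpairs_dep /=.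
  under eq_bigr do rewrite (Artin_Schreier_factor pcharLp erefl) -big_enum.
  by rewrite eqpxx.
apply/eqP; rewrite eqEsubv subvf -ts_gen; apply: adjoin_seqSr => t ts_t.
(* The shift by [0] shows that each generator is itself one of the roots. *)
apply/allpairsP; exists (t, 0); rewrite /= ts_t mem_enum; split=> //.
by rewrite (Fp_embed0 pcharLp) addr0.
Qed.

Lemma Artin_Schreier_separable : separable 1 {:L}.
Proof.
rewrite -ts_gen; apply/separable_Fadjoin_seq/allP=> t ts_t.
apply/separable_elementP; exists ('X^p - 'X - (t ^+ p - t)%:P); split.
- exact/Artin_Schreier_poly_over1/ts_toral.
- by rewrite rootE !hornerE subrr.
- exact: Artin_Schreier_separable_poly.
Qed.

End Normality.

Section GaloisOver1.
Variable L : splittingFieldType Z.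

Lemma mem_gal1 (s : gal_of {:L}) : s \in ('Gal({:L} / 1))%g.
Proof. by rewrite gal_kHom ?sub1v // k1HomE ahomWin. Qed.

Lemma gal_fix1 (s : gal_of {:L}) a : a \in 1%VS -> s a = a.
Proof. exact: fixed_gal (sub1v _) (mem_gal1 s). Qed.

End GaloisOver1.

Section Group.
Variables (L : splittingFieldType Z) (pcharLp : p \in [pchar L]).
Variables (d : nat) (ts : d.-tuple L).
Hypotheses (ts_toral : {in ts, forall t, t ^+ p - t \in 1%VS})
           (ts_gen : <<1 & ts>>%VS = {:L}%VS)
           (ts_free : free (1 :: ts)).
Let G := ('Gal({:L} / 1))%G.

(** Since [s] fixes [t ^+ p - t], Frobenius fixes [s t - t], which therefore lies in the prime
    field. *)
Lemma gal_toral_shift (s : gal_of {:L}) t : t ^+ p - t \in 1%VS ->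
  exists a : 'F_p, s t = t + Fp_embed L a.
Proof.
move=> /(gal_fix1 s) fix_t.
have [|a Da] := @Fp_embed_surj L p pcharLp (s t - t); last first.
  by exists a; rewrite -Da addrC subrK.
rewrite exprDp // exprNp //; move: fix_t; rewrite rmorphB rmorphXn /= => fix_t.
have -> : s t ^+ p = t ^+ p - t + s t by rewrite -fix_t subrK.
by rewrite addrAC [_ - t - _]addrAC subrr sub0r addrC.
Qed.

(** The default [0] is never reached, by [gal_toral_shift]. *)
Definition toral_shift (s : gal_of {:L}) : 'rV['F_p]_d :=
  \row_i odflt 0 [pick a : 'F_p | s (tnth ts i) == tnth ts i + Fp_embed L a].

Lemma toral_shiftE (s : gal_of {:L}) i :
  s (tnth ts i) = tnth ts i + Fp_embed L (toral_shift s 0 i).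
Proof.
rewrite mxE; case: pickP => [a /eqP // | no_a].
have [a Da] := gal_toral_shift s (ts_toral (mem_tnth i ts)).
by case/eqP: (no_a a).
Qed.

(** Automorphisms fix the prime field, so shifts add up under composition; the group law on row
    vectors is addition. *)
Lemma toral_shiftM :
  {in G &, {morph toral_shift : s u / (s * u)%g >-> (s * u)%g}}.
Proof.
move=> s u _ _; apply/rowP=> i; rewrite [RHS]mxE.
apply: (@Fp_embed_inj L p pcharLp); apply: (addrI (tnth ts i)).
rewrite -toral_shiftE galM ?memvf // toral_shiftE rmorphD /= toral_shiftE.
by rewrite (Fp_embedD pcharLp) -!addrA /= rmorph_nat [X in _ + X]addrC.
Qed.

Canonical toral_shift_morphism := Morphism toral_shiftM.

Lemma toral_shift_injm : ('injm toral_shift)%g.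
Proof.
apply/subsetP=> s /morphpreP[_ /set1P s0]; apply/set1P/eqP/gal_eqP=> x _.
have Fx : x \in fixedField [set s]; last first.
  by have /mem_fixedFieldP[_ ->] := Fx; rewrite ?gal_id ?inE.
have: x \in <<1 & ts>>%VS by rewrite ts_gen memvf.
move: x; apply/subvP; apply/Fadjoin_seqP.
split=> [|_ /tnthP[i ->]]; first exact: sub1v.
apply/fixedFieldP=> [|_ /set1P->]; first exact: memvf.
by rewrite toral_shiftE s0 mxE (Fp_embed0 pcharLp) addr0.
Qed.

Hypothesis galL : galois 1 {:L}.

Lemma toral_shift_surj : (toral_shift @* G)%g = [set: 'rV['F_p]_d].
Proof.
apply: Fp_subgroup_full => c annc.
(* Pairing the shift of [s] with [c] gives [s w - w], so an annihilator [c] makes [w]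
   Galois-invariant. *)
pose w := \sum_i Fp_embed Z (c i 0) *: tnth ts i.
have embedZ a x : Fp_embed Z a *: x = @Fp_embed L p a * x.
  by rewrite scaler_nat mulr_natl.
have w1 : w \in 1%VS.
  move/galois_fixedField: galL => <-; apply/fixedFieldP; first exact: memvf.
  move=> s Gs; rewrite /w linear_sum /=; apply/eqP; rewrite -subr_eq0 -sumrB.
  have /annc/matrixP/(_ 0 0) := mem_morphim toral_shift_morphism Gs Gs.
  rewrite !mxE => /(congr1 (@Fp_embed L p)).
  rewrite (Fp_embed_sum pcharLp) (Fp_embed0 pcharLp) => /eqP; congr (_ == 0).
  apply: eq_bigr => i _; rewrite linearZ /= -scalerBr toral_shiftE addrAC subrr.
  by rewrite add0r embedZ (Fp_embedM pcharLp) mulrC.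
have pcharZp : p \in [pchar Z] by rewrite -(pchar_lalg L).
move: ts_free; rewrite free_cons => /andP[ts'1 /freeP free_ts].
(* A nonzero scalar [w] would put [1] in the span of [ts]. *)
have w0 : w = 0.
  have /vlineP[z Dw] := w1; have [z0 | nz_z] := eqVneq z 0.
    by rewrite Dw z0 scale0r.
  case/negP: ts'1; rewrite -[1](scalerK nz_z) -Dw memvZ //.
  apply: rpred_sum => i _; exact/memvZ/memv_span/mem_tnth.
apply/colP=> i; rewrite mxE; apply/eqP; rewrite -(Fp_embed_eq0 pcharZp).
apply/eqP; apply: (free_ts (fun i => Fp_embed Z (c i 0))).
by rewrite -[RHS]w0; apply: eq_bigr => j _; rewrite (tnth_nth 0).
Qed.

Lemma gal_toral_isog : G \isog [set: 'rV['F_p]_d].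
Proof.
apply/isogP; exists toral_shift_morphism; last exact: toral_shift_surj.
exact: toral_shift_injm.
Qed.

End Group.

(** * From the Galois group back to toral generators *)

Section Converse.
Variables (L : splittingFieldType Z) (pcharLp : p \in [pchar L]).
Hypothesis galL : galois 1 {:L}.
Let G := ('Gal({:L} / 1))%G.

(** By independence of automorphisms the trace is not identically zero; its values are scalars, so
    one can be normalised. *)
Lemma galTrace1_exists : exists a : L, galTrace 1 {:L} a = 1.
Proof.
have [||a _ nz_a] := @gal_independent_contra _ L {:L}%AS [in G] (fun=> 1) 1%g.
- exact: group1.
- exact: oner_neq0.
have /vlineP[z Dz] := mem_galTrace galL (memvf a).
have Dsum : \sum_(y in G) 1 * y a = z%:A.
  by rewrite -Dz; apply: eq_bigr => y _; rewrite mul1r.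
have nz_z : z != 0 by apply: contraNneq nz_a => z0; rewrite Dsum z0 scale0r.
exists (z^-1 *: a); rewrite /galTrace.
under eq_bigr do rewrite linearZ /=.
by rewrite -scaler_sumr -[\sum_(_ in _) _]/(galTrace 1 {:L} a) Dz scalerK.
Qed.

(* Additive Hilbert 90: a homomorphism [G -> F_p] is a 1-cocycle with values *)
(* in [L], hence a coboundary.                                               *)
Lemma toral_of_hom (chi : gal_of {:L} -> 'F_p) :
    {in G &, {morph chi : s u / (s * u)%g >-> s + u}} ->
  exists2 t : L, t ^+ p - t \in 1%VS &
    {in G, forall s : gal_of {:L}, s t = t + Fp_embed L (chi s)}.
Proof.
move=> chiM; have [a tr_a] := galTrace1_exists.
(* Reindexing by [u * s] gives [s t - t] as [chi s] times the trace of [a], which is 1. *)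
pose t := - \sum_(u in G) Fp_embed L (chi u) * u a.
have shift_t : {in G, forall s : gal_of {:L}, s t = t + Fp_embed L (chi s)}.
  move=> s Gs.
  have -> : Fp_embed L (chi s) = \sum_(u in G) Fp_embed L (chi s) * u a.
    by rewrite -mulr_sumr [\sum_(u in G) _]tr_a mulr1.
  rewrite /t rmorphN rmorph_sum; apply: oppr_inj.
  rewrite opprK opprD opprK -sumrB.
  rewrite [RHS](reindex_inj (mulIg s)) /=; apply: eq_big => [u|u Gu].
    by rewrite groupMr.
  rewrite chiM // (Fp_embedD pcharLp) galM ?memvf // mulrDl addrK.
  by rewrite rmorphM rmorph_nat.
exists t => //; have fixG : fixedField G = 1%VS by apply/galois_fixedField.
rewrite -fixG; apply/fixedFieldP=> [|s Gs]; first exact: memvf.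
rewrite rmorphB rmorphXn /= shift_t // exprDp // Fp_embedX //.
by rewrite opprD addrACA subrr addr0.
Qed.

Variable d : nat.
Hypothesis isoG : G \isog [set: 'rV['F_p]_d].

(** Each [t i] realises the [i]-th coordinate of [G]. An automorphism fixing all of them has zero
    coordinates, hence is trivial, so they generate [L] by Galois correspondence. *)
Lemma toral_generators_of_isog : exists ts : d.-tuple L,
  [/\ {in ts, forall t, t ^+ p - t \in 1%VS}, <<1 & ts>>%VS = {:L}%VS
    & free (1 :: ts)].
Proof.
have [f injf imf] := isogP isoG.
have /fin_all_exists2[t t_toral shift_t] (i : 'I_d) :
  exists2 t : L, t ^+ p - t \in 1%VS &
    {in G, forall s : gal_of {:L}, s t = t + Fp_embed L (f s 0 i)}.
  apply: (toral_of_hom (chi := fun s => f s 0 i)) => s u Gs Gu.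
  by rewrite morphM // mxE.
exists [tuple t i | i < d]; split.
- by move=> _ /mapP[i _ ->].
- pose E : {subfield L} := <<1 & [tuple t i | i < d]>>%AS.
  have galE : galois E {:L} by apply: galoisS galL; rewrite sub1v subvf.
  have trivE : ('Gal({:L} / E))%g = 1%g.
    apply/trivgP/subsetP=> s Es; apply: (subsetP injf); rewrite !inE.
    have Gs : s \in G by apply: subsetP Es; apply/galS/sub1v.
    rewrite Gs /=; apply/eqP/rowP=> i; rewrite [RHS]mxE.
    apply: (@Fp_embed_inj L p pcharLp); apply: (addrI (t i)).
    rewrite -shift_t // (Fp_embed0 pcharLp) addr0.
    apply: (fixed_gal (subvf E) Es); apply: seqv_sub_adjoin.
    by apply/mapP; exists i; rewrite ?mem_enum.
  rewrite -[LHS]/(E : {vspace L}) -(galois_fixedField galE) trivE.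
  apply/eqP; rewrite eqEsubv subvf; apply/subvP=> x _.
  apply/fixedFieldP=> [|_ /set1P->]; first exact: memvf.
  exact: gal_id.
(* The automorphism with coordinates the [j]-th unit vector moves the combination by exactly [k j],
   yet fixes scalars. *)
have indep (k : 'I_d -> Z) : \sum_i k i *: t i \in 1%VS -> forall i, k i = 0.
  move=> Zkt j.
  have /morphimP[s _ Gs Ds] : delta_mx 0 j \in (f @* G)%g by rewrite imf inE.
  have/eqP := gal_fix1 s Zkt; rewrite linear_sum /= -subr_eq0 -sumrB.
  rewrite (bigD1 j) //= big1 => [|i i'j].
    rewrite addr0 linearZ /= -scalerBr shift_t // -Ds mxE !eqxx.
    rewrite (Fp_embed1 pcharLp).
    by rewrite [_ + 1]addrC addrK scaler_eq0 oner_eq0 orbF => /eqP.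
  rewrite linearZ /= -scalerBr shift_t // -Ds mxE (negPf i'j) andbF.
  by rewrite (Fp_embed0 pcharLp) addr0 subrr scaler0.
have sumE (k : 'I_d -> Z) :
    \sum_i k i *: [tuple t i | i < d]`_i = \sum_i k i *: t i.
  by apply: eq_bigr => i _; rewrite -tnth_nth tnth_mktuple.
rewrite free_cons; apply/andP; split; last first.
  by apply/freeP=> k; rewrite sumE => kt0; apply: indep; rewrite kt0 mem0v.
(* If [1] were in the span, [indep] would kill its coordinates and give [1 = 0]. *)
apply/negP=> /coord_span; rewrite sumE => D1.
have := mem1v (1%AS : {aspace L}); rewrite [X in X \in _]D1 => /indep c0.
by have := oner_neq0 L; rewrite D1 big1 ?eqxx // => i _; rewrite c0 scale0r.
Qed.

End Converse.

End ArtinSchreier.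

Lemma galois_with_elementary_groupP (Z : fieldType) (p d : nat)
    (L : fieldExtType Z) (pcharLp : p \in [pchar L]) :
  galois_with_group L [group of [set: 'rV['F_p]_d]] <->
  exists ts : d.-tuple L,
    [/\ {in ts, forall t, t ^+ p - t \in 1%VS}, <<1 & ts>>%VS = {:L}%VS
      & free (1 :: ts)].
Proof.
split=> [[nL [galL isoG]] | [ts [torL genL freeL]]].
  pose S := splitting_pack nL.
  exact: (@toral_generators_of_isog Z p S pcharLp galL d isoG).
have nL := Artin_Schreier_normal pcharLp torL genL.
have galL : galois (1%VS : {vspace splitting_pack nL}) {:splitting_pack nL}.
  rewrite /galois sub1v normalFieldf andbT /=.
  exact: (Artin_Schreier_separable pcharLp torL genL).
exists nL; split=> //.
exact: (@gal_toral_isog Z p (splitting_pack nL) pcharLp d ts).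
Qed.

(** * Toral bases and the rank of a torus *)

Lemma free_subseq_span (F : fieldType) (V : vectType F) (X s : seq V) :
  free X ->
  exists2 r, subseq r s & free (X ++ r) /\ <<X ++ r>>%VS = <<X ++ s>>%VS.
Proof.
elim: s X => [|v s IHs] X freeX; first by exists [::]; rewrite ?cats0.
have [Xv | X'v] := boolP (v \in <<X>>%VS).
  have [r sub_rs [freeXr eqXr]] := IHs X freeX.
  exists r; first exact: subseq_trans sub_rs (subseq_cons s v).
  split=> //; rewrite eqXr !span_cat span_cons addvA; congr (_ + _)%VS.
  by apply/esym/addv_idPl; rewrite -memvE.
have [|r sub_rs] := IHs (rcons X v).
  by rewrite (perm_free (permEl (perm_rcons v X))) free_cons X'v.
by rewrite !cat_rcons; exists (v :: r); rewrite //= eqxx.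
Qed.

(** The kernel of [ad] is the centre, here the line of [1], which lies in [T] and accounts for the
    extra dimension. *)
Lemma torus_rankE (Z : fieldType) (D : falgType Z) (T : {vspace D}) :
  'Z({:D})%VS = 1%VS -> 1 \in T -> (torus_rank T).+1 = \dim T.
Proof.
move=> centD T1.
rewrite -(limg_ker_dim (linfun (@ad Z D)) T) -add1n; congr (_ + _)%N.
rewrite -[LHS](dimv1 D); congr (\dim _); apply/eqP.
rewrite eqEsubv; apply/andP; split.
  apply/subvP=> z /vlineP[k ->]; rewrite memv_cap memvZ //= memv_ker lfunE /=.
  apply/eqP/lfunP=> x; rewrite adE lfunE /= -scalerAl -scalerAr.
  by rewrite mul1r mulr1 subrr.
rewrite -centD; apply/subvP=> t; rewrite !memv_cap memvf memv_ker lfunE /=.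
case/andP=> _ /eqP ad0; apply/centvP=> x _; apply/eqP.
by rewrite -subr_eq0 -adE ad0 lfunE.
Qed.

(** * Transfer between [K] inside [D] and the abstract field [L] *)

Section Transfer.
Variables (Z : fieldType) (D : falgType Z) (p : nat) (K : {aspace D}).
Hypotheses (hD : p_division_algebra D p) (hK : is_extension_field K).

Let L := extension_field hD hK.

Fact extension_field_val_ahom :
  ahom_in {:L} (linfun (@vsval Z D K) : 'Hom(L, D)).
Proof.
apply/ahom_inP; split=> [x y _ _|]; rewrite !lfunE //=.
(* The unit of [L] is the internal identity of [K], which is that of [D] because [1] lies in [K]. *)
exact: (unitr_algid1 (extf1 hK) (unitr1 D)).
Qed.

Definition extension_field_val : 'AHom(L, D) := AHom extension_field_val_ahom.

Lemma extension_field_valE (x : L) :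
  extension_field_val x = vsval (x : subvs_of K).
Proof. by rewrite /= lfunE. Qed.

Lemma limg_extension_field_val : limg extension_field_val = K.
Proof.
apply/eqP; rewrite eqEsubv; apply/andP; split; apply/subvP=> x.
  by case/memv_imgP=> y _ ->; rewrite extension_field_valE subvsP.
move=> Kx; apply/memv_imgP; exists (vsproj K x : L); first exact: memvf.
by rewrite extension_field_valE vsprojK.
Qed.

Lemma extension_field_val_inj : injective extension_field_val.
Proof. by move=> x y; rewrite !extension_field_valE => /val_inj. Qed.

Lemma pchar_extension_field : p \in [pchar L].
Proof. by rewrite (pchar_lalg L) -(pchar_lalg D) (pdiv_char hD). Qed.

Lemma extension_field_val_toral (x : L) :
  (extension_field_val x ^+ p - extension_field_val x \in 'Z({:D})%VS)
  = (x ^+ p - x \in 1%VS).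
Proof.
rewrite (pdiv_center hD) -rmorphXn -rmorphB /= -(aimg1 extension_field_val).
apply/idP/idP=> [/memv_imgP[y Zy] | Zx]; last exact: memv_img.
by move/extension_field_val_inj->.
Qed.

Lemma extension_field_val_free (s : seq L) :
  free [seq extension_field_val x | x <- s] = free s.
Proof.
rewrite /free -limg_span limg_dim_eq ?size_map //.
apply/eqP; rewrite -subv0; apply/subvP=> x.
rewrite memv_cap memv_ker memv0 => /andP[_ /eqP vx0]; apply/eqP.
by apply: extension_field_val_inj; rewrite vx0 rmorph0.
Qed.

(** In finite dimension a subalgebra is stable under inversion, so only commutativity is inherited
    from [K]. *)
Lemma subalgebra_is_extension_field (F : {aspace D}) :
  1 \in F -> (F <= K)%VS -> is_extension_field F.
Proof.
move=> F1 /subvP sFK; split=> // [x y Fx Fy | x]; last by rewrite memvV.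
by apply: (extf_comm hK); apply: sFK.
Qed.

Lemma generated_field_span (s : seq L) :
  generated_field <<1%R :: map extension_field_val s>>%VS K <->
  <<1 & s>>%VS = {:L}%VS.
Proof.
have im_s : (extension_field_val @: <<1 & s>>)%VS
    = <<1 & map extension_field_val s>>%VS.
  by rewrite aimg_adjoin_seq aimg1.
split=> [[_ _ minK] | gen_s].
  pose F := <<1 & map extension_field_val s>>%AS.
  have F1 : 1 \in F by rewrite memvE sub1_agenv.
  have sFK : (F <= K)%VS.
    rewrite /F /= -im_s -[X in (_ <= X)%VS]limg_extension_field_val.
    exact/limgS/subvf.
  have /minK : is_extension_field F by apply: subalgebra_is_extension_field.
  (* Minimality of [K] against the algebra [F] puts [K] inside the image of [<<1 & s>>]; injectivity
     pulls this back to [L]. *)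
  rewrite span_cons sub_agenv => /(_ isT); rewrite /= -im_s => sK.
  apply/eqP; rewrite eqEsubv subvf; apply/subvP=> x _.
  have : extension_field_val x \in K.
    by rewrite -limg_extension_field_val memv_img ?memvf.
  by move/(subvP sK)/memv_imgP=> [y sy /extension_field_val_inj ->].
have genK : (<<1 & map extension_field_val s>>)%VS = K.
  by rewrite -im_s gen_s limg_extension_field_val.
split=> // [|F extF]; first by rewrite -genK span_cons sub_agenv.
rewrite -genK span_cons => sF; apply: agenv_sub_modl.
  by rewrite -memvE (extf1 extF).
by apply: prodv_sub.
Qed.

End Transfer.

Theorem theorem1p1p4 (p : nat) (hp : prime p) (Z : fieldType) (D : falgType Z)
    (hD : p_division_algebra D p) (K : {aspace D}) (hK : is_extension_field K)
    (d : nat) :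
  (exists T : {vspace D},
     [/\ torus p T, (T <= K)%VS, torus_rank T = d & generated_field T K])
  <->
  galois_with_group (extension_field hD hK) [group of [set: 'rV['F_p]_d]].
Proof.
set L := extension_field hD hK; pose v := extension_field_val hD hK.
have pcharLp : p \in [pchar L] := pchar_extension_field hD hK.
have v1 (s : seq L) : map v (1 :: s) = 1 :: map v s.
  by rewrite map_cons (rmorph1 v).
have v_free (s : seq L) : free (map v s) = free s.
  exact: extension_field_val_free.
apply: iff_trans (iff_sym (galois_with_elementary_groupP d pcharLp)).
split=> [[T [[_ [s tor_s DT] T1] sTK rkT genT]] |
        [ts [tor_ts gen_ts free_ts]]].
  have free1 : free [:: 1 : D] by rewrite seq1_free oner_eq0.
  (* Thin the toral spanning list to a basis of [T] starting with [1]; [r] has [d] elements since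
     [T] has dimension [d + 1]. *)
  have [r sub_rs [free_r span_r]] := free_subseq_span s free1.
  have {}DT : T = <<1%R :: r>>%VS.
    rewrite -[1 :: r]/([:: 1] ++ r) span_r span_cons -DT.
    by apply/esym/addv_idPr; rewrite -memvE.
  have v_r : map v (map (vsproj K : D -> L) r) = r.
    rewrite -map_comp -[RHS]map_id; apply/eq_in_map=> t r_t.
    rewrite /= extension_field_valE vsprojK // (subvP sTK) // DT.
    by rewrite memv_span // inE r_t orbT.
  have size_r : size (map (vsproj K : D -> L) r) == d.
    rewrite size_map -eqSS -rkT (torus_rankE (pdiv_center hD)) // DT.
    by rewrite eq_sym; apply: free_r.
  exists (Tuple size_r); split.
  - move=> t r_t; rewrite -extension_field_val_toral.
    apply/(allP tor_s)/(mem_subseq sub_rs).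
    by rewrite -v_r map_f.
  - by apply/generated_field_span; rewrite /= v_r -DT.
  - by rewrite -v_free v1 v_r.
have genT : generated_field <<1%R :: map v ts>>%VS K.
  exact/generated_field_span.
exists <<1%R :: map v ts>>%VS; have [_ sTK _] := genT.
have commT : {in <<1%R :: map v ts>>%VS &, commutative *%R}.
  by move=> x y Tx Ty; apply: (extf_comm hK); apply: (subvP sTK).
have T1 : 1 \in <<1%R :: map v ts>>%VS by rewrite memv_span ?mem_head.
split=> //.
  split=> //; exists (1 :: map v ts) => //; apply/allP=> x; rewrite inE.
  case/predU1P=> [-> | /mapP[t ts_t ->]].
    by rewrite /toral expr1n subrr mem0v.
  by rewrite /toral extension_field_val_toral tor_ts.
apply: succn_inj; rewrite (torus_rankE (pdiv_center hD)) //.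
move: free_ts; rewrite -v_free v1 => /eqP->.
by rewrite /= size_map size_tuple.
Qed.
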